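(* Let $w\in\mathbb{C}$ with $|w|=1$, let $m\in\mathbb{N}$, let $\varphi$ be an analytic self-map of $\mathbb{D}$ with $\varphi'(0)=0$, and let $\psi\in H(\mathbb{D})$ be not identically zero, such that $D_{m,\psi,\varphi}$ is bounded and $J_w$-symmetric on $H^2(\beta)$. Then $D_{m,\psi,\varphi}$ is normal if and only if $\overline{\varphi(0)}=\bar w\,\varphi(0)$.
   Context: $\mathbb{N}=\{0,1,2,\dots\}$. $\mathbb{D}$ is the open unit disc in $\mathbb{C}$ and $H(\mathbb{D})$ is the space of analytic functions on $\mathbb{D}$. $\{\beta(n)\}_{n\ge 0}$ is a sequence of positive numbers with $\beta(0)=1$ and $\liminf_{n}\beta(n)^{1/n}\ge 1$. The weighted Hardy space $H^2(\beta)$ is the Hilbert space of all $f(z)=\sum_{n\ge0}a_nz^n\in H(\mathbb{D})$ with $\|f\|^2=\sum_{n\ge 0}|a_n|^2\beta(n)^2<\infty$, with inner product $\langle f,g\rangle=\sum_{n\ge 0}a_n\overline{c_n}\beta(n)^2$ for $g(z)=\sum_{n\ge 0}c_nz^n$. For $m\in\mathbb{N}$, $\psi\in H(\mathbb{D})$ and an analytic self-map $\varphi$ of $\mathbb{D}$, the generalized weighted composition operator is $D_{m,\psi,\varphi}f(z)=\psi(z)f^{(m)}(\varphi(z))$. For $w\in\mathbb{C}$ with $|w|=1$, the conjugation $J_w$ on $H^2(\beta)$ (conjugate-linear, isometric, $J_w^2=I$) is $J_wf(z)=\overline{f(w\bar z)}$. A bounded linear operator $T$ on $H^2(\beta)$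 is $J_w$-symmetric if $T=J_wT^*J_w$, and normal if $TT^*=T^*T$. *)

(* Defs.v *)
(* MathComp / MathComp-Analysis, with the complex numbers R[i] of
   mathcomp-real-closed over an arbitrary realType R. *)
From HB Require Import structures.
From mathcomp Require Import all_boot all_order all_algebra.
From mathcomp Require Import all_classical all_reals all_analysis.
From mathcomp Require Import complex.
Set Implicit Arguments.
Unset Strict Implicit.
Unset Printing Implicit Defensive.
Import Order.TTheory GRing.Theory Num.Theory numFieldNormedType.Exports.
Local Open Scope classical_set_scope.
Local Open Scope ring_scope.

(* R[i] packaged as a numClosedFieldType: it then inherits the norm topology of
   a numFieldType, its elements being scalars and vectors at the same time, so
   that [derivable] and [derive1n] below are complex differentiation. *)
Definition Cplx (R : realType) : numClosedFieldType := R[i]%C.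

Definition toC (R : realType) (x : R) : Cplx R := (x%:C)%C.

Definition cmod (R : realType) (z : Cplx R) : R := ComplexField.Normc.normc z.

Definition disc (R : realType) : set (Cplx R) := [set z | cmod z < 1].

(* Functions on the disc are total functions Cplx R -> Cplx R of which only the
   values on the disc matter; equality of such functions is [eq_disc]. *)
Definition eq_disc (R : realType) (f g : Cplx R -> Cplx R) : Prop :=
  forall z, disc z -> f z = g z.

Definition analytic_disc (R : realType) (f : Cplx R -> Cplx R) : Prop :=
  forall z, disc z -> derivable f z 1.

Definition analytic_self_map (R : realType) (phi : Cplx R -> Cplx R) : Prop :=
  analytic_disc phi /\ forall z, disc z -> disc (phi z).

Definition weight_seq (R : realType) (beta : nat -> R) : Prop :=
  [/\ forall n, 0 < beta n,
      beta 0%N = 1 &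
      (1%:E <= limn_einf (fun n => (beta n `^ (n%:R^-1))%:E))%E].

Definition power_series_of (R : realType) (f : Cplx R -> Cplx R)
    (a : nat -> Cplx R) : Prop :=
  forall z, disc z -> series (fun n => a n * z ^+ n) @ \oo --> f z.

(* The coefficient sequence of f; power series expansions on the disc are
   unique, and the zero sequence is a junk value when f has none. *)
Definition coef (R : realType) (f : Cplx R -> Cplx R) : nat -> Cplx R :=
  xget (fun=> 0) [set a | power_series_of f a].

Section WeightedHardySpace.
Variables (R : realType) (beta : nat -> R).
Local Notation C := (Cplx R).
Implicit Types (f g : C -> C) (T S : (C -> C) -> (C -> C)).

Definition sqnorm_terms f (n : nat) : R := cmod (coef f n) ^+ 2 * beta n ^+ 2.

Definition hardy f : Prop :=
  [/\ analytic_disc f,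
      exists a, power_series_of f a &
      cvgn (series (sqnorm_terms f))].

Definition hnorm f : R := Num.sqrt (limn (series (sqnorm_terms f))).

Definition inner f g : C :=
  limn (series (fun n => coef f n * (coef g n)^* * toC (beta n) ^+ 2)).

Definition bounded_on_hardy T : Prop :=
  (forall f, hardy f -> hardy (T f)) /\
  exists M : R, forall f, hardy f -> hnorm (T f) <= M * hnorm f.

(* S is the Hilbert space adjoint of T; it is unique up to [eq_disc] on
   H^2(beta), and it exists whenever T is a bounded linear operator. *)
Definition is_adjoint T S : Prop :=
  (forall f, hardy f -> hardy (S f)) /\
  forall f g, hardy f -> hardy g -> inner (T f) g = inner f (S g).

Definition conjJ (w : C) f : C -> C := fun z => (f (w * z^*))^*.

Definition J_symmetric (w : C) T : Prop :=
  exists2 S, is_adjoint T S &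
    forall f, hardy f -> eq_disc (T f) (conjJ w (S (conjJ w f))).

Definition normal_operator T : Prop :=
  exists2 S, is_adjoint T S &
    forall f, hardy f -> eq_disc (T (S f)) (S (T f)).

End WeightedHardySpace.

Definition gwco (R : realType) (m : nat) (psi phi : Cplx R -> Cplx R)
    (f : Cplx R -> Cplx R) : Cplx R -> Cplx R :=
  fun z => psi z * derive1n m f (phi z).

(* Main.v *)
(* Test the operator T f = psi * (f^(m) o phi) on the monomials. J_w-symmetry
   says that the matrix of T, rescaled by w^j beta(j)^2, is symmetric. The first
   m columns of T vanish, hence so do the first m rows, i.e. psi = O(z^m). Rows m
   and m + 1 of T are computed from the expansion of psi * phi^k at 0 up to
   order m + 1, which only sees phi(0) since phi'(0) = 0. By symmetry this gives
   columns m and m + 1, that is psi and psi * phi: one finds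
   psi * phi = phi(0) * psi, so that T f = f^(m)(phi(0)) psi has rank one, and
   psi is explicit. Writing T f = g <f, k> psi with k = T^* z^m, normality means
   that k is proportional to psi; the coefficients of index m and m + 1 decide. *)
Require Import Defs.
From HB Require Import structures.
From mathcomp Require Import all_boot all_order all_algebra.
From mathcomp Require Import all_classical all_reals all_analysis.
From mathcomp Require Import complex.
From mathcomp Require Import ring.
Set Implicit Arguments.
Unset Strict Implicit.
Unset Printing Implicit Defensive.
Import Order.TTheory GRing.Theory Num.Theory numFieldNormedType.Exports.
Local Open Scope classical_set_scope.
Local Open Scope ring_scope.

(** * Coefficients of power series on the disc *)

Section Basics.
Variable R : realType.
Local Notation C := (Cplx R).
Implicit Types (z : C) (f g : C -> C) (a b : nat -> C).

Lemma norm_toC_cmod z : `|z| = toC (cmod z).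
Proof. by []. Qed.

Lemma discE z : disc z <-> `|z| < 1.
Proof. by rewrite norm_toC_cmod -[X in _ < X]/(toC 1) /toC ltcR. Qed.

Lemma sum_expr_half_le (x : C) n : 0 <= x <= 2^-1 -> \sum_(i < n) x ^+ i <= 2.
Proof.
move=> /andP[x0 x2]; suff : \sum_(i < n) x ^+ i <= 2 - x ^+ n *+ (n == 0)%N.
  by move/le_trans; apply; rewrite lerBlDr lerDl mulrn_wge0// exprn_ge0.
case: n => [|n]; first by rewrite big_ord0 expr0 mulr1n subr_ge0 ler1n.
rewrite mulr0n subr0; elim: n => [|n ih].
  by rewrite big_ord1 expr0 ler1n.
rewrite big_ord_recl expr0 (_ : \sum_(i < _) _ = x * \sum_(i < n.+1) x ^+ i).
  rewrite [leRHS](_ : 2 = 1 + 2^-1 * 2); last by rewrite mulVf ?pnatr_eq0.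
  rewrite lerD2l ler_pM// ; apply: sumr_ge0 => i _; exact: exprn_ge0.
by rewrite mulr_sumr; apply: eq_bigr => i _; rewrite /= /bump add1n exprS.
Qed.

(** Convergence at 1/2 bounds the terms there, so [|a k| <= M * 2 ^+ k]. For [|z| <= 1/4] the tail
    is then dominated by a geometric series of ratio [2 * |z| <= 1/2], whose sum is at most 2. *)
Lemma power_series_tail f a N : power_series_of f a ->
  exists2 M : C, 0 <= M & forall z, `|z| <= 4^-1 ->
    `|f z - \sum_(k < N) a k * z ^+ k| <= M * `|z| ^+ N.
Proof.
move=> fa; have half1 : disc (2^-1 : C).
  by apply/discE; rewrite ger0_norm ?invr_ge0 ?ler0n// invf_lt1 ?ltr0n// ltr1n.
have /cvgP/cvg_series_cvg_0/cvgP/cvg_seq_bounded/pinfty_ex_gt0[M M0 /= aM]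
  := fa _ half1.
have {}aM k : `|a k| <= M * 2 ^+ k.
  have := aM k I; rewrite normrM normrX [`|2^-1|]ger0_norm ?invr_ge0 ?ler0n//.
  by rewrite exprVn ler_pdivrMr// exprn_gt0.
exists (M * 2 ^+ N * 2); first by rewrite !mulr_ge0 ?exprn_ge0// ltW.
move=> z z4; apply/ler_addgt0Pr => e e0.
have zd : disc z.
  apply/discE/(le_lt_trans z4); rewrite invf_lt1 ?ltr0n// ltr1n.
  by [].
(* A partial sum of length [N + n] is taken so that its first [N] terms cancel against [S]; the
   bound on the rest does not depend on [n]. *)
have /cvgrPdist_le/(_ _ e0)[n _ /(_ (N + n)%N)] := fa _ zd.
rewrite /= leq_addl => /(_ isT) fn.
set S := \sum_(_ < _) _; set T := series _ _ in fn.
rewrite (_ : f z - S = (f z - T) + (T - S)); last by rewrite subrKA.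
apply: (le_trans (ler_normD _ _)); rewrite [leRHS]addrC lerD// /T /series/= /S.
rewrite big_mkord big_split_ord/= addrAC subrr add0r.
apply: (le_trans (ler_norm_sum _ _ _)).
apply: (@le_trans _ _ (\sum_(i < n)
    M * 2 ^+ N * `|z| ^+ N * (2 * `|z|) ^+ i)).
  apply: ler_sum => i _; rewrite normrM normrX.
  rewrite (_ : _ * _ * _ * _ = M * 2 ^+ (N + i) * `|z| ^+ (N + i)).
    by rewrite ler_wpM2r ?exprn_ge0.
  rewrite !exprD exprMn -!mulrA; congr (_ * (_ * _)); exact: mulrCA.
rewrite -mulr_sumr [leRHS]mulrAC ler_wpM2l ?mulr_ge0 ?exprn_ge0 ?(ltW M0)//.
apply: sum_expr_half_le; rewrite mulr_ge0//=.
apply: (le_trans (ler_wpM2l _ z4)) => //.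
by rewrite (natrM _ 2 2) invfM mulrA divff ?pnatr_eq0// mul1r.
Qed.

(** Once the coefficients below [n] vanish, [|a n| * |z| ^+ n] is at most [|f z|] plus a tail of
    order [n + 1]. Dividing by [|z| ^+ n] makes [a n] arbitrarily small. *)
Lemma power_series_little_o f a N : power_series_of f a ->
  (forall e : C, 0 < e -> \forall z \near (0 : C), `|f z| <= e * `|z| ^+ N) ->
  forall n, (n <= N)%N -> a n = 0.
Proof.
move=> fa fo; elim/ltn_ind => n ih nN.
have [M M0 tailM] := power_series_tail n.+1 fa.
apply/eqP; rewrite -normr_le0; apply/ler_addgt0Pr => e e0; rewrite add0r.
have e20 : 0 < e / 2 by rewrite divr_gt0.
(* For [|z| <= d] the tail contributes at most [e / 2 * |z| ^+ n]; [M + 1] keeps the divisor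
   positive when [M] is 0. *)
pose d : C := e / 2 / (M + 1).
have M10 : 0 < M + 1 by rewrite ltr_wpDl.
have d0 : 0 < d by rewrite divr_gt0.
have /filter_ex[z [z0 [zd [z4 [z1 fz]]]]] : \forall z \near (0 : C)^',
    z != 0 /\ (`|z| <= d /\ (`|z| <= 4^-1 /\ (`|z| <= 1 /\
      `|f z| <= e / 2 * `|z| ^+ N))).
  near=> z; split; first by near: z; exact: nbhs_dnbhs_neq.
  split; first by near: z; exact: dnbhs0_le.
  split; first by near: z; apply: dnbhs0_le; rewrite invr_gt0.
  split; first by near: z; exact: dnbhs0_le.
  by near: z; apply: nbhs_dnbhs; exact: fo.
have zn0 : 0 < `|z| by rewrite normr_gt0.
have := tailM _ z4.
rewrite big_ord_recr/= big1 ?add0r; last first.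
  by move=> i _; rewrite ih ?mul0r// (leq_trans (ltnW (ltn_ord i))).
move=> fa_z.
rewrite -(@ler_pM2r _ (`|z| ^+ n)) ?exprn_gt0// -normrX -normrM.
rewrite (_ : a n * z ^+ n = f z - (f z - a n * z ^+ n)); last by rewrite subKr.
apply: (le_trans (ler_normB _ _)); rewrite [e](splitr e) mulrDl lerD//.
  apply: (le_trans fz); rewrite normrX ler_pM2l//.
  by rewrite ler_wiXn2l.
apply: (le_trans fa_z); rewrite exprS mulrA normrX ler_pM2r ?exprn_gt0//.
apply: (@le_trans _ _ ((M + 1) * d)); last by rewrite /d mulrC divfK ?gt_eqF.
by rewrite ler_pM// lerDl.
Unshelve. all: by end_near. Qed.

Lemma power_seriesB f g a b : power_series_of f a -> power_series_of g b ->
  power_series_of (f \- g) (fun n => a n - b n).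
Proof.
move=> fa gb z zd; rewrite (_ : series _ =
  series (fun n => a n * z ^+ n) \- series (fun n => b n * z ^+ n)).
  exact: cvgB (fa _ zd) (gb _ zd).
by apply/funext => n; rewrite /series/= -sumrB; apply: eq_bigr => i _; rewrite mulrBl.
Qed.

Lemma power_series_eq_mod f g a b N :
  power_series_of f a -> power_series_of g b ->
  (forall e : C, 0 < e ->
    \forall z \near (0 : C), `|f z - g z| <= e * `|z| ^+ N) ->
  forall n, (n <= N)%N -> a n = b n.
Proof.
move=> fa gb fg n nN; apply/eqP; rewrite -subr_eq0; apply/eqP.
exact: (power_series_little_o (power_seriesB fa gb) fg).
Qed.

Lemma near0_disc : \forall z \near (0 : C), disc z.
Proof.
have : \forall z \near (0 : C), `|z| < 1 by exact: nbhs0_lt.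
by apply: filterS => z /discE.
Qed.

Lemma power_series_uniq f g a b : power_series_of f a -> power_series_of g b ->
  eq_disc f g -> a = b.
Proof.
move=> fa gb fg; apply/funext => n.
apply: (@power_series_eq_mod _ _ _ _ n fa gb) => // e e0.
by near=> z; rewrite fg ?subrr ?normr0 ?mulr_ge0 ?exprn_ge0// ?ltW//; near: z;
  exact: near0_disc.
Unshelve. all: by end_near. Qed.

Lemma power_series_eq_disc f g a : eq_disc f g ->
  power_series_of f a -> power_series_of g a.
Proof. by move=> fg fa z zd; rewrite -fg//; exact: fa. Qed.

Lemma eq_disc_power_series f g a : power_series_of f a -> power_series_of g a ->
  eq_disc f g.
Proof.
by move=> fa ga z zd; exact: (cvg_unique (@norm_hausdorff _ _) (fa z zd) (ga z zd)).
Qed.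

Lemma coef_power_series f a : power_series_of f a -> coef f = a.
Proof.
move=> fa; rewrite /coef; case: xgetP => [b _ fb|/(_ a)/(_ fa)//].
exact: power_series_uniq fb fa _.
Qed.

Lemma coef_eq_disc f g : eq_disc f g -> coef f = coef g.
Proof.
move=> fg; have [[a fa]|nf] := pselect (exists a, power_series_of f a).
  by rewrite (coef_power_series fa) (coef_power_series (power_series_eq_disc fg fa)).
(* Without an expansion [coef] takes its default value 0, and [f] and [g] lack one together. *)
have coef0 h : ~ (exists a, power_series_of h a) -> coef h = fun=> 0.
  by move=> nh; rewrite /coef; case: xgetP => // a _ ha; case: nh; exists a.
have ng : ~ (exists a, power_series_of g a).
  case=> a ga; apply: nf; exists a.
  by apply: (power_series_eq_disc _ ga) => z zd; rewrite fg.
by rewrite (coef0 _ nf) (coef0 _ ng).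
Qed.

Lemma power_series_coef f : (exists a, power_series_of f a) -> power_series_of f (coef f).
Proof. by move=> [a fa]; rewrite (coef_power_series fa). Qed.

Lemma power_seriesZ (c : C) f a : power_series_of f a ->
  power_series_of (fun z => c * f z) (fun n => c * a n).
Proof.
move=> fa z zd; rewrite (_ : series _ =
  fun n => c * series (fun n => a n * z ^+ n) n).
  by apply: cvgMr; exact: fa.
by apply/funext => n; rewrite /series/= mulr_sumr; apply: eq_bigr => i _; rewrite mulrA.
Qed.

Lemma coef_scale (c : C) f g : (exists a, power_series_of g a) ->
  eq_disc f (fun z => c * g z) -> forall n, coef f n = c * coef g n.
Proof.
move=> /power_series_coef gps fg n; rewrite (coef_eq_disc fg).
by rewrite (coef_power_series (@power_seriesZ c _ _ gps)).
Qed.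

Lemma power_series_monomial n (c : C) :
  power_series_of (fun z => c * z ^+ n) (fun k => c *+ (k == n)).
Proof.
move=> z _; apply: cvg_near_cst; exists n.+1 => // k /= nk.
rewrite /series/= big_mkord (bigD1 (Ordinal nk))//= eqxx big1 ?addr0// => i.
by rewrite -val_eqE/= => /negPf ->; rewrite mul0r.
Qed.

Lemma coef_monomial n (c : C) k :
  coef (fun z => c * z ^+ n) k = c *+ (k == n).
Proof. by rewrite (coef_power_series (@power_series_monomial n c)). Qed.

End Basics.

(* Without this, failing unifications unfold xget and the limits and diverge. *)
#[local] Opaque coef.

(** * The inner product of H^2(beta) *)

Section Inner.
Variables (R : realType) (beta : nat -> R).
Local Notation C := (Cplx R).
Local Notation inner := (inner beta).
Local Notation hardy := (hardy beta).
Local Notation b2 n := (toC (beta n) ^+ 2).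
Implicit Types (z c w : C) (f g : C -> C) (a b u : nat -> C).

(* No convergence is assumed: if u diverges both limits are the junk value 0. *)
Lemma limn_scale c u : limn (fun n => c * u n) = c * limn u.
Proof.
have [->|c0] := eqVneq c 0.
  rewrite mul0r (_ : (fun _ => _) = cst 0) ?lim_cst//.
  by apply/funext => n; rewrite mul0r.
have [cu|du] := pselect (cvgn u).
  by apply: (cvg_lim (@norm_hausdorff _ _)); apply: cvgMr; exact: cu.
have dcu : ~ cvgn (fun n => c * u n).
  move=> /cvg_ex[l cul]; apply: du; apply/cvg_ex; exists (c^-1 * l).
  have : (fun n => c^-1 * (c * u n)) @ \oo --> c^-1 * l by exact: cvgMr.
  by under eq_fun do rewrite mulKf//.
by rewrite (dvgP du) (dvgP dcu) mulr0.
Qed.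

Lemma cvg_conj u (l : C) : u @ \oo --> l -> (fun n => (u n)^*) @ \oo --> l^*.
Proof.
move=> /cvgrPdist_le ul; apply/cvgrPdist_le => e /ul; apply: filterS => n.
by rewrite -rmorphB norm_conjC.
Qed.

(* Holds for divergent u too, as both limits are then the junk value 0. *)
Lemma limn_conj u : limn (fun n => (u n)^*) = (limn u)^*.
Proof.
have [cu|du] := pselect (cvgn u).
  by apply: (cvg_lim (@norm_hausdorff _ _)); apply: cvg_conj; exact: cu.
have dcu : ~ cvgn (fun n => (u n)^*).
  move=> /cvg_ex[l /cvg_conj cul]; apply: du; apply/cvg_ex; exists l^*.
  by move: cul; under eq_fun do rewrite conjCK.
by rewrite (dvgP du) (dvgP dcu) conjC0.
Qed.

Lemma conj_toC (x : R) : (toC x)^* = toC x.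
Proof. exact: conjc_real. Qed.

(** Only the coefficients are constrained and [limn_scale] covers divergent series, so no membership
    in H^2(beta) has to be checked. *)
Lemma innerZl c f f' g : (forall n, coef f n = c * coef f' n) ->
  inner f g = c * inner f' g.
Proof.
move=> ff'; rewrite /Defs.inner -limn_scale.
apply: (congr1 (fun u => limn u)); apply/funext => n.
rewrite /series/= mulr_sumr; apply: eq_bigr => i _.
by rewrite ff' !mulrA.
Qed.

Lemma inner_conj f g : (inner f g)^* = inner g f.
Proof.
rewrite /Defs.inner -limn_conj.
apply: (congr1 (fun u => limn u)); apply/funext => n.
rewrite /series/= rmorph_sum; apply: eq_bigr => i _.
by rewrite !rmorphM/= conjCK conj_toC [(coef f i)^* * _]mulrC.
Qed.

Lemma inner_selfM c f g :
  (forall n, `|coef f n| ^+ 2 = c * `|coef g n| ^+ 2) ->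
  inner f f = c * inner g g.
Proof.
move=> fg; rewrite /Defs.inner -limn_scale.
apply: (congr1 (fun u => limn u)); apply/funext => n.
rewrite /series/= mulr_sumr; apply: eq_bigr => i _.
rewrite mulrA; congr (_ * _); rewrite -[LHS]normCK fg; congr (_ * _).
exact: normCK.
Qed.

Lemma innerZr c f g g' : (forall n, coef g n = c * coef g' n) ->
  inner f g = c^* * inner f g'.
Proof. by move=> gg'; rewrite -inner_conj (innerZl _ gg') rmorphM/= inner_conj. Qed.

Lemma inner_monomial_l c n g :
  inner (fun z => c * z ^+ n) g = c * (coef g n)^* * b2 n.
Proof.
apply: (cvg_lim (@norm_hausdorff _ _)); apply: cvg_near_cst; exists n.+1 => // k /= nk.
rewrite /series/= big_mkord (bigD1 (Ordinal nk))//= coef_monomial eqxx big1 ?addr0// => i.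
by rewrite -val_eqE/= coef_monomial => /negPf ->; rewrite !mul0r.
Qed.

Lemma inner_monomial_r c n f :
  inner f (fun z => c * z ^+ n) = c^* * coef f n * b2 n.
Proof. by rewrite -inner_conj inner_monomial_l !rmorphM/= conjCK conj_toC. Qed.

Lemma cvg_toC (u : nat -> R) (l : R) :
  u @ \oo --> l -> (fun n => toC (u n)) @ \oo --> toC l.
Proof.
move=> ul; apply/cvgrPdist_lt => e e0.
(* In the order of [R[i]] a positive element is real, so [e] comes from [R]. *)
have [e' e'E e'0] : exists2 e' : R, e = toC e' & 0 < e'.
  exists (complex.Re e); last by move: e0; rewrite ltcE => /andP[].
  by apply/esym; rewrite /toC RRe_real// gtr0_real.
move/cvgrPdist_lt : ul => /(_ _ e'0); apply: filterS => n.
by rewrite e'E /toC -rmorphB/= norm_toC_cmod /toC /cmod/= expr0n/= addr0 sqrtr_sqr ltcR.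
Qed.

Lemma inner_self f : hardy f ->
  inner f f = toC (limn (series (sqnorm_terms beta f))).
Proof.
move=> [_ _ cf]; apply: (cvg_lim (@norm_hausdorff _ _)).
rewrite (_ : series _ = fun n => toC (series (sqnorm_terms beta f) n)).
  exact: cvg_toC.
apply/funext => n; rewrite /toC /series/= rmorph_sum; apply: eq_bigr => i _.
by rewrite -normCK /sqnorm_terms rmorphM/= !rmorphXn.
Qed.

Lemma inner_self_neq0 f n : hardy f -> 0 < beta n -> coef f n != 0 ->
  inner f f != 0.
Proof.
move=> hf bn fn; rewrite inner_self//; have [_ _ cf] := hf.
suff : 0 < limn (series (sqnorm_terms beta f)).
  by move/gt_eqF/negbT; apply: contraNN => /eqP[->].
have sn i : 0 <= sqnorm_terms beta f i by rewrite mulr_ge0 ?sqr_ge0.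
apply: (@lt_le_trans _ _ (series (sqnorm_terms beta f) n.+1)); last first.
  by apply: nondecreasing_cvgn_le => //; exact: nondecreasing_series.
rewrite /series/= big_nat_recr//= ltr_wpDl ?sumr_ge0// mulr_gt0 ?exprn_gt0//.
by move: fn; rewrite -normr_gt0 norm_toC_cmod -[X in X < _]/(toC 0) /toC ltcR.
Qed.

Lemma derivable_monomial n c z : derivable (fun z => c * z ^+ n) z 1.
Proof.
apply: (@derivableM _ _ (cst c) (fun z => z ^+ n)); first exact: derivable_cst.
exact: exprn_derivable.
Qed.

(** For [m > n] the truncated exponent is harmless, since [n ^_ m] is 0. *)
Lemma derive1n_monomial m n c :
  derive1n m (fun z => c * z ^+ n) = fun z => c * (n ^_ m)%:R * z ^+ (n - m).
Proof.
elim: m => [|m ih].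
  by rewrite derive1n0 subn0 ffactn0 mulr1.
rewrite derive1nS ih; apply/funext => z.
rewrite derive1Ml; last exact: exprn_derivable.
by rewrite exp_derive1 ffactnSr natrM subnS -!mulrA.
Qed.

Lemma hardy_monomial n c : hardy (fun z => c * z ^+ n).
Proof.
split.
- by move=> z _; exact: derivable_monomial.
- by exists (fun k => c *+ (k == n)); exact: power_series_monomial.
- apply/cvg_ex; exists (cmod c ^+ 2 * beta n ^+ 2).
  apply: cvg_near_cst; exists n.+1 => // k /= nk.
  rewrite /series/= big_mkord (bigD1 (Ordinal nk))//= /sqnorm_terms.
  rewrite coef_monomial eqxx big1 ?addr0// => i.
  rewrite -val_eqE/= coef_monomial => /negPf ->.
  by rewrite /cmod mulr0n ComplexField.Normc.normc0 expr0n/= mul0r.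
Qed.

Lemma conjJ_power_series w g b : `|w| = 1 -> power_series_of g b ->
  power_series_of (conjJ w g) (fun n => (b n * w ^+ n)^*).
Proof.
move=> w1 gb z zd; have wzd : disc (w * z^*).
  by apply/discE; rewrite normrM w1 mul1r norm_conjC; apply/discE.
rewrite (_ : series _ = fun n => (series (fun n => b n * (w * z^*) ^+ n) n)^*).
  by apply: cvg_conj; exact: gb.
apply/funext => n; rewrite /series/= rmorph_sum; apply: eq_bigr => i _.
by rewrite exprMn mulrA rmorphM/= -rmorphXn/= conjCK.
Qed.

Lemma conjJ_monomial w n c :
  conjJ w (fun z => c * z ^+ n) = fun z => (c * w ^+ n)^* * z ^+ n.
Proof.
apply/funext => z; rewrite /conjJ exprMn mulrA rmorphM/=; congr (_ * _).
by rewrite -rmorphXn/= conjCK.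
Qed.

End Inner.

#[local] Opaque coef power_series_of inner.

(** * Matrix entries of adjoints and of J-symmetric operators *)

Section Operators.
Variables (R : realType) (beta : nat -> R).
Local Notation C := (Cplx R).
Local Notation inner := (inner beta).
Local Notation hardy := (hardy beta).
Local Notation b2 n := (toC (beta n) ^+ 2).
Implicit Types (z c w : C) (f g : C -> C) (T S : (C -> C) -> (C -> C)).

(* The factor 1 makes it an instance of the scaled monomials c * z ^+ n above. *)
Definition monomial n : C -> C := fun z => 1 * z ^+ n.

(** Pairing with [z^n] reads off a coefficient of [S f]; every later fact about an adjoint is
    obtained this way. *)
Lemma coef_adjoint T S f n : is_adjoint beta T S -> hardy f ->
  (coef (S f) n)^* * b2 n = inner (T (monomial n)) f.
Proof.
move=> [_ TS] hf; rewrite (TS _ _ (hardy_monomial _ _ _) hf).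
by rewrite inner_monomial_l mul1r.
Qed.

(* The rescaled matrix (T z^n)_j w^j beta(j)^2 of T is symmetric: compare
   coefficients in T z^n = J_w T^* J_w z^n, where J_w z^n = conj(w^n) z^n. *)
Lemma J_symmetric_coef T w j n :
  `|w| = 1 -> J_symmetric beta w T ->
  coef (T (monomial n)) j * w ^+ j * b2 j =
  coef (T (monomial j)) n * w ^+ n * b2 n.
Proof.
move=> w1 [S adjS TJS]; set g := conjJ w (monomial n).
have gE : g = fun z => (w ^+ n)^* * z ^+ n.
  by rewrite /g conjJ_monomial mul1r.
have hg : hardy g by rewrite gE; exact: hardy_monomial.
have [_ Sps _] := adjS.1 _ hg.
have -> : coef (T (monomial n)) j = (coef (S g) j * w ^+ j)^*.
  rewrite (coef_eq_disc (TJS _ (hardy_monomial _ _ _))).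
  by rewrite (coef_power_series (conjJ_power_series w1 (power_series_coef Sps))).
have wj : (w ^+ j)^* * w ^+ j = 1 by rewrite mulrC -normCK normrX w1 !expr1n.
rewrite rmorphM/= -[_ * _ * w ^+ j]mulrA wj mulr1 (coef_adjoint _ adjS hg).
by rewrite gE inner_monomial_r conjCK [w ^+ n * _]mulrC.
Qed.

End Operators.

(** * Expansion of [psi * phi ^+ k] at a critical point of [phi] *)

Section LocalExpansion.
Variable R : realType.
Local Notation C := (Cplx R).

Lemma critical_little_o (f : C -> C) : derivable f 0 1 -> derive1 f 0 = 0 ->
  forall e : C, 0 < e -> \forall z \near (0 : C), `|f z - f 0| <= e * `|z|.
Proof.
move=> df f'0 e e0; rewrite derive1E in f'0.
have dfl : (fun h : C => h^-1 *: (f (h *: 1 + 0) - f 0)) @ (0 : C)^' --> 'D_1 f 0.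
  exact: df.
rewrite f'0 in dfl; have /cvgrPdist_le/(_ _ e0) := dfl.
rewrite near_withinE; apply: filterS => z zP.
have [->|z0] := eqVneq z 0; first by rewrite subrr !normr0 mulr0.
have := zP z0.
by rewrite sub0r normrN normrZ normfV addr0 [z *: 1]mulr1 mulrC ler_pdivrMr ?normr_gt0.
Qed.

Lemma critical_pow_little_o (f : C -> C) k : derivable f 0 1 -> derive1 f 0 = 0 ->
  forall e : C, 0 < e ->
    \forall z \near (0 : C), `|f z ^+ k - f 0 ^+ k| <= e * `|z|.
Proof.
move=> df f'0; have dfk : derivable (f ^+ k) 0 1 by exact: derivableX.
have fkE z : (f ^+ k) z = f z ^+ k by rewrite fctE.
have fk'0 : derive1 (f ^+ k) 0 = 0.
  by rewrite derive1E (deriveX k df) -derive1E f'0 scaler0.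
by move=> e e0; apply: filterS (critical_little_o dfk fk'0 e0) => z; rewrite !fkE.
Qed.

(* The factor psi = O(z^m) shifts phi^k = phi(0)^k + o(z) by m orders, which is
   why the comparison reaches index m + 1. *)
Lemma coef_mul_critical_pow (psi phi : C -> C) (p q : nat -> C) m k :
  power_series_of psi p -> (forall n, (n < m)%N -> p n = 0) ->
  derivable phi 0 1 -> derive1 phi 0 = 0 ->
  power_series_of (fun z => psi z * phi z ^+ k) q ->
  forall n, (n <= m.+1)%N -> q n = phi 0 ^+ k * p n.
Proof.
move=> psip p0 dphi phi'0 psiq.
suff mulo : forall e : C, 0 < e -> \forall z \near (0 : C),
    `|psi z * phi z ^+ k - phi 0 ^+ k * psi z| <= e * `|z| ^+ m.+1.
  exact: (power_series_eq_mod psiq (@power_seriesZ _ (phi 0 ^+ k) _ _ psip) mulo).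
move=> e e0.
have [M M0 psiM] := power_series_tail m psip.
have M10 : 0 < M + 1 by rewrite ltr_wpDl.
(* The product of the two bounds is [M / (M + 1) * e * |z| ^+ m.+1], which is at most what is
   required. *)
have eM : 0 < e / (M + 1) by rewrite divr_gt0.
have : \forall z \near (0 : C), `|z| <= 4^-1 by apply: nbhs0_le; rewrite invr_gt0.
apply: filterS2 (critical_pow_little_o k dphi phi'0 eM) => z phiz /psiM.
rewrite big1 => [|i _]; last by rewrite p0 ?mul0r.
rewrite subr0 => psiz; rewrite [phi 0 ^+ k * _]mulrC -mulrBr normrM.
apply: (le_trans (ler_pM _ _ psiz phiz)) => //.
rewrite exprSr !mulrA ler_wpM2r// -!mulrA mulrCA [leRHS]mulrC.
by rewrite ler_wpM2l ?exprn_ge0// mulrCA ger_pMr// ler_pdivrMr// mul1r lerDl.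
Qed.

End LocalExpansion.

(* For normal_gwco_conj: p and p1 are the coefficients of psi of index m and
   m + 1, wm = w^m, F = m!, B = beta(m)^2, B1 = beta(m + 1)^2, c = (m + 1)^_m
   and a = phi(0). *)
Lemma conj_eq_of_parallel (K : numClosedFieldType) (w wm F B B1 c p p1 a : K) :
  w * w^* = 1 -> wm * wm^* = 1 -> F^* = F -> B^* = B -> B1^* = B1 -> c^* = c ->
  F != 0 -> B != 0 -> c != 0 -> p != 0 ->
  p1 * F * w * B1 = B * c * a * p ->
  (F * wm * (p * wm)^*)^* * B * (F * wm * (p1 * (wm * w))^*) =
  F ^+ 2 * (p^* * B) * p1 ->
  a^* = w^* * a.
Proof.
move=> ww wmwm FJ BJ B1J cJ F0 B0 c0 p0 Ep.
have conjM (x y : K) : (x * y)^* = x^* * y^* by exact: rmorphM.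
have := congr1 (fun x => x^*) Ep; rewrite !conjM !conjCK FJ BJ B1J cJ => EpJ E.
have pJ0 : p^* != 0 by rewrite conjC_eq0.
(* Scaled by these nonzero factors, the left side contains the conjugate of the right side of [Ep].
   The conjugated relation, then [E], then [Ep] itself turn [a^*] into [w^* * a]. *)
apply: (mulfI F0); apply: (mulfI F0); apply: (mulfI B0); apply: (mulfI B0).
apply: (mulfI c0); apply: (mulfI p0); apply: (mulfI pJ0).
transitivity (F ^+ 2 * B * p * (B * c * a^* * p^*)); first by ring.
rewrite -EpJ.
transitivity (B1 * F * ((wm * wm^*) ^+ 2 * (F * F * B * p * (p1^* * w^*)))).
  by rewrite wmwm; ring.
transitivity (B1 * F * (w * w^* * (F ^+ 2 * (p^* * B) * p1))).
  by rewrite ww mul1r -E; ring.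
transitivity (F ^+ 2 * B * p^* * w^* * (p1 * F * w * B1)); first by ring.
by rewrite Ep; ring.
Qed.

(* For conj_normal_gwco, in the same notation at index m + j: wj = w^j,
   aj = phi(0)^j, Bj = beta(m + j)^2 and c = (m + j)^_m. *)
Lemma parallel_of_conj (K : numClosedFieldType) (wj wm F B Bj c p pj aj : K) :
  wm * wm^* = 1 -> wj * wj^* = 1 -> F^* = F -> B^* = B -> Bj^* = Bj -> c^* = c ->
  F != 0 -> Bj != 0 -> aj^* = wj^* * aj ->
  pj * F * wj * Bj = B * c * aj * p ->
  F * wm * (pj * (wm * wj))^* * p = F * p^* * pj.
Proof.
move=> wmwm wjwj FJ BJ BjJ cJ F0 Bj0 aJ Ep.
have conjM (x y : K) : (x * y)^* = x^* * y^* by exact: rmorphM.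
have := congr1 (fun x => x^*) Ep; rewrite !conjM FJ BJ BjJ cJ aJ => EpJ.
apply: (mulfI F0); apply: (mulfI Bj0).
transitivity (F * p * (wm * wm^*) * (pj^* * F * wj^* * Bj)); first by ring.
rewrite wmwm EpJ.
transitivity (F * p^* * wj^* * (B * c * aj * p)); first by ring.
rewrite -Ep; transitivity (F * p^* * (wj * wj^*) * (pj * F * Bj)); first by ring.
by rewrite wjwj; ring.
Qed.

(** * J-symmetric operators with a critical point of phi at 0 *)

Section Structure.
Variables (R : realType) (beta : nat -> R) (w : Cplx R) (m : nat)
  (phi psi : Cplx R -> Cplx R).
Local Notation C := (Cplx R).
Local Notation inner := (inner beta).
Local Notation hardy := (hardy beta).
Local Notation b2 n := (toC (beta n) ^+ 2).
Local Notation T := (gwco m psi phi).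
Local Notation p := (coef psi).
Hypotheses (beta_gt0 : forall n, 0 < beta n) (w1 : `|w| = 1).
Hypotheses (dphi : derivable phi 0 1) (phi'0 : derive1 phi 0 = 0).
Hypothesis psi_neq0 : exists2 z, disc z & psi z != 0.
Hypothesis hardyT : forall f, hardy f -> hardy (T f).
Hypothesis symT : J_symmetric beta w T.

(** * Rows and columns of the matrix of [T], and the shape of [psi] *)

Lemma weight2_neq0 n : b2 n != 0.
Proof.
rewrite expf_neq0//; apply/eqP => -[bn0].
by have := beta_gt0 n; rewrite bn0 ltxx.
Qed.

Lemma natC_neq0 k : (0 < k)%N -> k%:R != 0 :> C.
Proof. by rewrite pnatr_eq0 lt0n. Qed.

Lemma unimodular_pow_neq0 n : w ^+ n != 0.
Proof. by rewrite expf_neq0// -normr_gt0 w1. Qed.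

Lemma gwco_monomial n z :
  T (monomial n) z = (n ^_ m)%:R * (psi z * phi z ^+ (n - m)).
Proof. by rewrite /gwco /monomial derive1n_monomial mul1r mulrCA mulrA. Qed.

(** The expansion is inherited from [T z^(m + k)], which lies in H^2(beta) and is a nonzero multiple
    of [psi * phi ^+ k]. *)
Lemma power_series_psi_phi k : power_series_of (fun z => psi z * phi z ^+ k)
  (fun j => ((m + k) ^_ m)%:R^-1 * coef (T (monomial (m + k))) j).
Proof.
have [_ Tps _] := hardyT (hardy_monomial beta (m + k) 1).
have := @power_seriesZ _ (((m + k) ^_ m)%:R^-1) _ _ (power_series_coef Tps).
apply: power_series_eq_disc => z _; rewrite (gwco_monomial (m + k)) addKn mulKf//.
by rewrite natC_neq0// ffact_gt0 leq_addr.
Qed.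

Local Notation q k := (coef (fun z => psi z * phi z ^+ k)).

Lemma coef_gwco_monomial k j :
  coef (T (monomial (m + k))) j = ((m + k) ^_ m)%:R * q k j.
Proof.
rewrite (coef_power_series (@power_series_psi_phi k)) mulVKf//.
by rewrite natC_neq0// ffact_gt0 leq_addr.
Qed.

Lemma power_series_psi : power_series_of psi p.
Proof.
apply: power_series_coef; eexists.
apply: (power_series_eq_disc _ (@power_series_psi_phi 0)) => z _.
by rewrite expr0 mulr1.
Qed.

Lemma coef_psi_phi0 : q 0 = p.
Proof. by apply: coef_eq_disc => z _; rewrite expr0 mulr1. Qed.

Lemma coef_gwco_monomialm j : coef (T (monomial m)) j = (m`!)%:R * p j.
Proof.
by have := coef_gwco_monomial 0 j; rewrite coef_psi_phi0 addn0 ffactnn.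
Qed.

(** [T] kills [z^n] for [n < m], and symmetry turns this zero column into a zero row. *)
Lemma coef_psi_phi_small k n : (n < m)%N -> q k n = 0.
Proof.
move=> nm; have E := @J_symmetric_coef _ _ _ _ (m + k) n w1 symT.
have T0 : coef (T (monomial n)) (m + k) = 0.
  rewrite (@coef_eq_disc _ _ (fun z => 0 * z ^+ 0)).
    by rewrite coef_monomial mul0rn.
  by move=> z _; rewrite (gwco_monomial n) ffact_small// !mul0r.
rewrite T0 !mul0r in E.
have nz : ((m + k) ^_ m)%:R != 0 :> C by rewrite natC_neq0// ffact_gt0 leq_addr.
apply: (mulfI nz); rewrite mulr0 -coef_gwco_monomial.
apply: (mulIf (unimodular_pow_neq0 n)); apply: (mulIf (weight2_neq0 n)).
by rewrite -E !mul0r.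
Qed.

Lemma coef_psi_small n : (n < m)%N -> p n = 0.
Proof.
by move=> nm; rewrite -coef_psi_phi0 coef_psi_phi_small.
Qed.

Lemma coef_psi_phi k n : (n <= m.+1)%N -> q k n = phi 0 ^+ k * p n.
Proof.
apply: (coef_mul_critical_pow power_series_psi coef_psi_small dphi phi'0).
exact: power_series_coef (ex_intro _ _ (@power_series_psi_phi k)).
Qed.

(** Symmetry exchanges entry [m + k] of column [m], which is [m! * psi], with entry [m] of column
    [m + k], known from [coef_psi_phi]. All of [psi] is thus determined by [p m]. *)
Lemma coef_psi_rec k : p (m + k) * (m`!)%:R * w ^+ k * b2 (m + k) =
  b2 m * ((m + k) ^_ m)%:R * phi 0 ^+ k * p m.
Proof.
have := @J_symmetric_coef _ _ _ _ (m + k) m w1 symT.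
rewrite coef_gwco_monomialm coef_gwco_monomial coef_psi_phi ?leqnSn// exprD => E.
by apply: (mulfI (unimodular_pow_neq0 m)); ring: E.
Qed.

(** Symmetry exchanges entry [m + k] of column [m + 1] with entry [m + 1] of column [m + k], a
    multiple of [phi 0 ^+ k * p (m + 1)]. Then [coef_psi_rec 1] trades [p (m + 1)] for
    [phi 0 * p m], and [coef_psi_rec k] trades [phi 0 ^+ k * p m] for [p (m + k)]. *)
Lemma coef_psi_phi1 k : q 1 (m + k) = phi 0 * p (m + k).
Proof.
have := @J_symmetric_coef _ _ _ _ (m + k) (m + 1) w1 symT.
have m1 : (m + 1 <= m.+1)%N by rewrite addn1.
rewrite (coef_gwco_monomial 1) (coef_gwco_monomial k) (coef_psi_phi k m1) => E.
have E1 := coef_psi_rec 1; have Ek := coef_psi_rec k.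
have nzm : ((m`!)%:R : C) != 0 by rewrite natC_neq0// fact_gt0.
have nzm1 : (((m + 1) ^_ m)%:R : C) != 0 by rewrite natC_neq0// ffact_gt0 leq_addr.
apply: (mulfI nzm); apply: (mulfI nzm1).
apply: (mulfI (unimodular_pow_neq0 (m + k))); apply: (mulfI (weight2_neq0 (m + k))).
rewrite !exprD in E *; move: E E1 Ek; rewrite !expr1.
move: (w ^+ m) (w ^+ k) (phi 0 ^+ k) (b2 m) (b2 (m + 1)) (b2 (m + k)).
move: ((m + 1) ^_ m)%:R ((m + k) ^_ m)%:R (m`!)%:R => c1 ck c wm wk ak bm b1 bk E E1 Ek.
transitivity (c * (c1 * q 1 (m + k) * (wm * wk) * bk)); first by ring.
rewrite E; transitivity (ck * ak * wm * (p (m + 1) * c * w * b1)); first by ring.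
rewrite E1; transitivity (wm * c1 * phi 0 * (bm * ck * ak * p m)); first by ring.
by rewrite -Ek; ring.
Qed.

Lemma psi_phiE z : disc z -> psi z * phi z = phi 0 * psi z.
Proof.
move=> zd.
suff qE : q 1 = fun n => phi 0 * p n.
  have := power_series_coef (ex_intro _ _ (@power_series_psi_phi 1)).
  rewrite qE => ps1; have ps2 := @power_seriesZ _ (phi 0) _ _ power_series_psi.
  by have := eq_disc_power_series ps1 ps2 zd; rewrite expr1.
apply/funext => n; have [nm|mn] := ltnP n m.
  by rewrite coef_psi_phi_small// coef_psi_small// mulr0.
by rewrite -(subnKC mn) coef_psi_phi1.
Qed.

(** If [p m] vanished, [coef_psi_rec] would kill every higher coefficient, and the lower ones are
    already 0, so [psi] would vanish on the disc. *)
Lemma coef_psi_neq0 : p m != 0.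
Proof.
apply/eqP => pm0; case: psi_neq0 => z zd /eqP; apply.
suff p0 : p = fun n => 0 *+ (n == 0)%N.
  have ps := power_series_psi; rewrite p0 in ps.
  by rewrite (eq_disc_power_series ps (@power_series_monomial _ 0 0) zd) mul0r.
apply/funext => n; rewrite mul0rn; have [nm|mn] := ltnP n m.
  exact: coef_psi_small.
rewrite -(subnKC mn); have := coef_psi_rec (n - m); rewrite pm0 mulr0 => E.
apply: (mulIf (natC_neq0 (fact_gt0 m))); apply: (mulIf (unimodular_pow_neq0 (n - m))).
by apply: (mulIf (weight2_neq0 (m + (n - m)))); rewrite E !mul0r.
Qed.

(* Nothing is claimed about phi at the zeros of psi, where both sides vanish. *)
Lemma gwco_derive f z : disc z -> T f z = derive1n m f (phi 0) * psi z.
Proof.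
move=> zd; rewrite /gwco; have [->|psiz] := eqVneq (psi z) 0.
  by rewrite mul0r mulr0.
suff -> : phi z = phi 0 by exact: mulrC.
by apply: (mulfI psiz); rewrite psi_phiE// mulrC.
Qed.

(** * Rank one form of the operator and of its adjoint *)

Local Notation gam := ((p m * b2 m)^-1).

(** Pairing [T f] with [z^m] gives the derivative at [phi 0] times [p m * b2 m]; [gam] inverts that
    factor. *)
Lemma gwco_rank1 S f z : is_adjoint beta T S -> hardy f -> disc z ->
  T f z = gam * inner f (S (monomial m)) * psi z.
Proof.
move=> adjS hf zd; have [_ TS] := adjS.
rewrite -(TS _ _ hf (hardy_monomial _ _ _)) inner_monomial_r conjC1 mul1r.
have -> : coef (T f) m = derive1n m f (phi 0) * p m.
  apply: coef_scale => [|x xd]; first by exists p; exact: power_series_psi.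
  exact: gwco_derive.
rewrite gwco_derive// -[_ * p m * _]mulrA [gam * _]mulrC mulfK//.
by rewrite mulf_neq0 ?coef_psi_neq0 ?weight2_neq0.
Qed.

(** These are the coefficients of [m! * w ^+ m] times [conjJ w psi]: the adjoint reads row [m] of
    [T], which by symmetry is column [m], that is [m! * psi], up to weights and powers of [w]. *)
Lemma coef_gwco_adjoint S j : is_adjoint beta T S ->
  coef (S (monomial m)) j = (m`!)%:R * w ^+ m * (p j * w ^+ j)^*.
Proof.
move=> adjS; apply: (can_inj (@conjCK C)); apply: (mulIf (weight2_neq0 j)).
rewrite (coef_adjoint _ adjS (hardy_monomial _ _ _)) inner_monomial_r conjC1 mul1r.
have := @J_symmetric_coef _ _ _ _ j m w1 symT; rewrite coef_gwco_monomialm => E.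
have wm : (w ^+ m)^* * w ^+ m = 1 by rewrite mulrC -normCK normrX w1 !expr1n.
apply: (mulIf (unimodular_pow_neq0 m)); rewrite mulrAC -E.
rewrite !rmorphM/= conjC_nat !conjCK.
transitivity ((m`!)%:R * p j * w ^+ j * b2 j * ((w ^+ m)^* * w ^+ m)).
  by rewrite wm mulr1.
by ring.
Qed.

(** The adjoint of [f |-> gam * <f, k> * psi] is [f |-> gam^* * <f, psi> * k]. Two adjoints occur
    because [J_symmetric] and [normal_operator] each provide their own. *)
Lemma adjoint_gwco_rank1 S S' f z : is_adjoint beta T S -> is_adjoint beta T S' ->
  hardy f -> disc z ->
  S' f z = (gam * inner psi f)^* * S (monomial m) z.
Proof.
move=> adjS adjS' hf zd.
have [_ Sps _] := adjS.1 _ (hardy_monomial beta m 1).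
have [_ S'ps _] := adjS'.1 _ hf.
have ps := @power_seriesZ _ (gam * inner psi f)^* _ _ (power_series_coef Sps).
suff cE : coef (S' f) = fun n => (gam * inner psi f)^* * coef (S (monomial m)) n.
  have ps' := power_series_coef S'ps; rewrite cE in ps'.
  exact: eq_disc_power_series ps' ps _ zd.
apply/funext => n; apply: (can_inj (@conjCK C)); apply: (mulIf (weight2_neq0 n)).
rewrite (coef_adjoint _ adjS' hf) rmorphM/= conjCK.
have TE j : coef (T (monomial n)) j = gam * inner (monomial n) (S (monomial m)) * p j.
  apply: coef_scale => [|x xd]; first by exists p; exact: power_series_psi.
  exact: gwco_rank1 (hardy_monomial _ _ _) xd.
rewrite (innerZl _ _ TE) inner_monomial_l mul1r.
by ring.
Qed.

(** * Commutation with the adjoint and normality *)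

Lemma inner_psi_neq0 : inner psi psi != 0.
Proof.
(* Positivity of the norm is carried over from [T z^m], which lies in H^2(beta) and has the
   coefficients of [psi] times [m!]. *)
have hTm := hardyT (hardy_monomial beta m 1).
have Tm j : coef (T (monomial m)) j = (m`!)%:R * p j by exact: coef_gwco_monomialm.
have Tmm : coef (T (monomial m)) m != 0.
  by rewrite Tm mulf_neq0 ?coef_psi_neq0 ?natC_neq0 ?fact_gt0.
have := inner_self_neq0 hTm (beta_gt0 m) Tmm; apply: contraNN => /eqP psi0.
rewrite (inner_selfM _ (c := `|(m`!)%:R| ^+ 2) (g := psi)) ?psi0 ?mulr0//.
by move=> n; rewrite Tm normrM exprMn.
Qed.

(** With [k = S z^m], the two products are [|gam|^2 <k, k> <f, psi> psi] and
    [|gam|^2 <psi, psi> <f, k> k]. The factor [m!^2] appears because [k] has norm [m!] times that of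
    [psi]; the common nonzero factor cancels. *)
Lemma gwco_commute S S' f z : is_adjoint beta T S -> is_adjoint beta T S' ->
  hardy f -> disc z ->
  T (S' f) z = S' (T f) z <->
  (m`!)%:R ^+ 2 * inner f psi * psi z =
    inner f (S (monomial m)) * S (monomial m) z.
Proof.
move=> adjS adjS' hf zd.
set k := S (monomial m).
have [_ kps _] := adjS.1 _ (hardy_monomial beta m 1).
have S'E n : coef (S' f) n = (gam * inner psi f)^* * coef k n.
  by apply: coef_scale => // x xd; exact: adjoint_gwco_rank1.
have TE n : coef (T f) n = gam * inner f k * p n.
  apply: coef_scale => [|x xd]; first by exists p; exact: power_series_psi.
  exact: gwco_rank1.
have kk : inner k k = (m`!)%:R ^+ 2 * inner psi psi.
  apply: inner_selfM => n; rewrite (coef_gwco_adjoint _ adjS).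
  by rewrite !normrM norm_conjC normrM !normrX w1 !expr1n !mulr1 normr_nat exprMn.
have gam0 : gam * gam^* * inner psi psi != 0.
  rewrite mulf_neq0 ?inner_psi_neq0// mulf_neq0 ?conjC_eq0//;
  by rewrite invr_eq0 mulf_neq0 ?coef_psi_neq0 ?weight2_neq0.
have conjM (x y : C) : (x * y)^* = x^* * y^* by exact: rmorphM.
have TS'E : T (S' f) z =
    gam * gam^* * inner psi psi * ((m`!)%:R ^+ 2 * inner f psi * psi z).
  rewrite (gwco_rank1 adjS (adjS'.1 _ hf) zd) (innerZl _ _ S'E) kk.
  move: gam => g; rewrite conjM (inner_conj beta psi f).
  move: (inner psi psi) (inner f psi) (psi z) => x y u.
  by move: (m`!)%:R => c; ring.
have S'TE : S' (T f) z =
    gam * gam^* * inner psi psi * (inner f k * k z).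
  rewrite (adjoint_gwco_rank1 adjS adjS' (hardyT hf) zd) (innerZr _ _ TE).
  have ppJ := inner_conj beta psi psi.
  move: gam ppJ => g; rewrite -/k.
  move: (inner psi psi) (inner f k) (k z) => x y u xJ.
  by rewrite !conjM !conjCK xJ; ring.
rewrite TS'E S'TE; split=> E; first exact: (mulfI gam0 E).
exact: (congr1 (fun x => gam * gam^* * inner psi psi * x) E).
Qed.

Lemma normal_gwco_conj : normal_operator beta T ->
  (phi 0)^* = w^* * phi 0.
Proof.
have [S adjS _] := symT; case=> S' adjS' TS'.
have hm := hardy_monomial beta m 1.
have [_ kps _] := adjS.1 _ hm.
have kE z : disc z -> (m`!)%:R ^+ 2 * inner (monomial m) psi * psi z =
    inner (monomial m) (S (monomial m)) * S (monomial m) z.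
  by move=> zd; apply/(gwco_commute adjS adjS' hm zd); exact: TS' hm _ zd.
have wj j : w ^+ j * (w ^+ j)^* = 1 by rewrite -normCK normrX w1 !expr1n.
(* The relation is tested on [f = z^m] and read at index [m + 1], where [coef_psi_rec 1] brings in
   [phi 0] to the first power. *)
have /esym : coef (fun z => (m`!)%:R ^+ 2 * inner (monomial m) psi * psi z) (m + 1) =
    inner (monomial m) (S (monomial m)) * coef (S (monomial m)) (m + 1).
  by apply: coef_scale => // z zd; exact: kE.
rewrite (coef_power_series (@power_seriesZ _ _ _ _ power_series_psi)).
have innerE g : inner (monomial m) g = (coef g m)^* * b2 m.
  by rewrite inner_monomial_l mul1r.
rewrite (innerE psi) (innerE (S (monomial m))).
rewrite (coef_gwco_adjoint m adjS) (coef_gwco_adjoint (m + 1) adjS).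
rewrite [w ^+ (m + 1)]exprD expr1 => E.
have Er := coef_psi_rec 1; rewrite !expr1 in Er.
have b2J n : (b2 n)^* = b2 n by rewrite /toC -rmorphXn; exact: conj_toC.
have F0 : (m`!)%:R != 0 :> C by rewrite natC_neq0 ?fact_gt0.
have c0 : ((m + 1) ^_ m)%:R != 0 :> C by rewrite natC_neq0 ?ffact_gt0 ?leq_addr.
have ww : w * w^* = 1 by have := wj 1; rewrite expr1.
exact: (conj_eq_of_parallel ww (wj m) (conjC_nat _ _) (b2J m) (b2J (m + 1))
  (conjC_nat _ _) F0 (weight2_neq0 m) c0 coef_psi_neq0 Er E).
Qed.

Lemma conj_normal_gwco : (phi 0)^* = w^* * phi 0 -> normal_operator beta T.
Proof.
move=> aJ; have [S adjS _] := symT; exists S => // f hf z zd.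
apply/(gwco_commute adjS adjS hf zd).
(* [nu] is the ratio of the coefficients of index [m] of [S z^m] and [psi], with modulus [m!]. Once
   [S z^m = nu * psi], both sides of the commutation relation agree. *)
pose nu : C := (m`!)%:R * (p m)^* / p m.
have nuJ : nu^* * nu = (m`!)%:R ^+ 2.
  have F0 := coef_psi_neq0; have FJ0 : (p m)^* != 0 by rewrite conjC_eq0.
  rewrite /nu; move: (p m) F0 FJ0 => x x0 xJ0.
  rewrite [(_ / _)^*]rmorphM/= fmorphV/= [(_ * _)^*]rmorphM/= conjCK conjC_nat.
  by move: (m`!)%:R => c; field; rewrite x0.
have [_ kps _] := adjS.1 _ (hardy_monomial beta m 1).
have b2J n : (b2 n)^* = b2 n by rewrite /toC -rmorphXn; exact: conj_toC.
have wj j : w ^+ j * (w ^+ j)^* = 1 by rewrite -normCK normrX w1 !expr1n.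
have kE n : coef (S (monomial m)) n = nu * p n.
  rewrite (coef_gwco_adjoint n adjS); have [nm|mn] := ltnP n m.
    by rewrite (coef_psi_small nm) mul0r conjC0 !mulr0.
  (* From index [m] on, the hypothesis on [phi 0] passes to its powers, so the explicit form of
     [psi] and its conjugate differ by the constant phase needed. *)
  have Er := coef_psi_rec (n - m); rewrite subnKC// in Er.
  have aJn : (phi 0 ^+ (n - m))^* = (w ^+ (n - m))^* * phi 0 ^+ (n - m).
    by rewrite !rmorphXn/= aJ exprMn.
  have F0 : (m`!)%:R != 0 :> C by rewrite natC_neq0 ?fact_gt0.
  rewrite -[in w ^+ n](subnKC mn) exprD /nu [RHS]mulrAC.
  apply: (mulIf coef_psi_neq0); rewrite divfK ?coef_psi_neq0//.
  have natJ k : (k%:R : C)^* = k%:R by exact: conjC_nat.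
  exact: (parallel_of_conj (wj m) (wj (n - m)%N) (natJ _) (b2J m) (b2J n)
    (natJ _) F0 (weight2_neq0 n) aJn Er).
have kz : S (monomial m) z = nu * psi z.
  have ps := power_series_coef kps.
  rewrite (_ : coef _ = fun n => nu * p n) in ps; last exact/funext.
  exact: (eq_disc_power_series ps (@power_seriesZ _ nu _ _ power_series_psi) zd).
rewrite kz (innerZr _ _ kE) -nuJ.
by move: (inner f psi) (nu^*) => x y; ring.
Qed.

End Structure.

Theorem theorem5 (R : realType) (beta : nat -> R) (w : Cplx R) (m : nat)
    (phi psi : Cplx R -> Cplx R)
    (hbeta : weight_seq beta)
    (hw : cmod w = 1)
    (hphi : analytic_self_map phi)
    (hphi0 : derive1 phi 0 = 0)
    (hpsi : analytic_disc psi)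
    (hpsi0 : exists2 z, disc z & psi z != 0)
    (hbdd : bounded_on_hardy beta (gwco m psi phi))
    (hsym : J_symmetric beta w (gwco m psi phi)) :
  normal_operator beta (gwco m psi phi) <-> (phi 0)^* = w^* * phi 0.
Proof.
have w1 : `|w| = 1 by rewrite norm_toC_cmod hw.
have [beta_gt0 _ _] := hbeta.
have dphi : derivable phi 0 1 by apply: hphi.1; apply/discE; rewrite normr0.
split; first exact: (normal_gwco_conj beta_gt0 w1 dphi hphi0 hpsi0 hbdd.1 hsym).
exact: (conj_normal_gwco beta_gt0 w1 dphi hphi0 hpsi0 hbdd.1 hsym).
Qed.
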